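(* Let $L$ be a complete and completely distributive lattice, $G$ a group, $\mu$ an $L$-subgroup of $G$, and let $\eta$ be a normal $L$-subgroup of $\mu$. Then $\eta$ is a pronormal $L$-subgroup of $\mu$.
   Context: $L$ has least element $0$ and greatest element $1$. An $L$-subset of $G$ is a function $G \to L$; inclusion $\eta\subseteq\mu$ means $\eta(x)\le\mu(x)$ for all $x\in G$; unions and intersections of $L$-subsets are pointwise joins and meets. An $L$-subgroup of $G$ is a function $\mu: G\to L$ with $\mu(xy)\ge\mu(x)\wedge\mu(y)$ and $\mu(x^{-1})=\mu(x)$ for all $x,y\in G$; $L(G)$ is the set of these. For $\mu\in L(G)$, $L(\mu)$ denotes the set of $\eta\in L(G)$ with $\eta\subseteq\mu$ (the $L$-subgroups of $\mu$). For an $L$-subset $\theta$ of $G$, $\langle\theta\rangle$ is the smallest $L$-subgroup of $G$ containing $\theta$, and $\langle\eta,\nu\rangle=\langle\eta\cup\nu\rangle$. $L$-points: for $a\in L$, $x\in G$, the $L$-point $a_x$ is the $L$-subset with value $a$ at $x$ and $0$ elsewhere; $a_x\in\mu$ means $\mu(x)\ge a$. Conjugate: for $\eta\in L(\mu)$ and $a_z\in\mu$, $\eta^{a_z}$ is the $L$-subgroup of $\mu$ given by $\eta^{a_z}(x)=a\wedge\eta(zxz^{-1})$ for all $x\in G$. Pronormal: $\eta\in L(\mu)$ is a pronormal $L$-subgroup of $\mu$ if for every $L$-point $a_x\in\mu$ there exists an $L$-point $b_y\in\langle\eta,\eta^{a_x}\rangle$ such that $\eta^{b_y}=\eta^{a_x}$.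 Normal: $\eta\in L(\mu)$ is a normal $L$-subgroup of $\mu$ if $\eta(yxy^{-1})\ge\eta(x)\wedge\mu(y)$ for all $x,y\in G$. *)

(* Defs.v *)
From HB Require Import structures.
From mathcomp Require Import all_boot all_order.
From mathcomp Require Import boolp classical_sets.

Set Implicit Arguments.
Unset Strict Implicit.
Unset Printing Implicit Defensive.

Import Order.TTheory.

Local Open Scope classical_set_scope.
Local Open Scope order_scope.

HB.mixin Record TBLattice_isComplete d (L : Type) of Order.TBLattice d L := {
  cjoin : set L -> L;
  cmeet : set L -> L;
  cjoinP : forall A : set L, supremums A (cjoin A);
  cmeetP : forall A : set L, infimums A (cmeet A)
}.

#[short(type="completeLatticeType")]
HB.structure Definition CompleteLattice d :=
  { L of TBLattice_isComplete d L & Order.TBLattice d L }.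

(* The family (J i) may be empty, or have empty members; the functions f in   *)
(* the right-hand side are the choice functions of the family.                *)
HB.mixin Record CompleteLattice_isCompletelyDistr d (L : Type)
    of CompleteLattice d L := {
  cmeet_cjoin : forall (I : Type) (J : I -> set L),
    cmeet [set cjoin (J i) | i in [set: I]] =
    cjoin [set cmeet [set f i | i in [set: I]]
          | f in [set f : I -> L | forall i, J i (f i)]] :> L
}.

#[short(type="completelyDistrLatticeType")]
HB.structure Definition CompletelyDistrLattice d :=
  { L of CompleteLattice_isCompletelyDistr d L & CompleteLattice d L }.

Section LSubgroups.

Context {d : Order.disp_t} {L : completeLatticeType d} {G : groupType}.

Implicit Types (eta mu nu theta : G -> L) (a b : L) (x y z : G).

Definition Lsubset eta mu : Prop := forall x, eta x <= mu x.

Definition Lunion eta nu : G -> L := fun x => Order.join (eta x) (nu x).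

Definition Lsubgroup mu : Prop :=
  (forall x y, Order.meet (mu x) (mu y) <= mu (x * y)%g) /\
  (forall x, mu (x^-1)%g = mu x).

Definition Lsubgroup_of mu eta : Prop := Lsubgroup eta /\ Lsubset eta mu.

(* Pointwise meet of the L-subgroups containing theta; the three lemmas       *)
(* Lgenerated_subgroup, Lgenerated_sub and Lgenerated_min below state that it *)
(* is the smallest of them.                                                   *)
Definition Lgenerated theta : G -> L := fun x =>
  cmeet [set nu x | nu in [set nu : G -> L | Lsubgroup nu /\ Lsubset theta nu]].

Definition Lpoint a x : G -> L := fun y => if y == x then a else \bot.

(* Membership of an L-point in an L-subset, and conjugation by an L-point,    *)
(* take the pair (a, x) rather than the function Lpoint a x. This is harmless *)
(* by Lpoint_inP and Lconj_Lpoint: although Lpoint \bot x does not determine  *)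
(* x, both notions only depend on the function.                               *)
Definition Lpoint_in a x mu : Prop := a <= mu x.

Definition Lconj eta a z : G -> L :=
  fun x => Order.meet a (eta (z * x * z^-1)%g).

Definition Lpronormal mu eta : Prop :=
  Lsubgroup_of mu eta /\
  forall a x, Lpoint_in a x mu ->
    exists b y, Lpoint_in b y (Lgenerated (Lunion eta (Lconj eta a x))) /\
                Lconj eta b y = Lconj eta a x.

Definition Lnormal mu eta : Prop :=
  Lsubgroup_of mu eta /\
  forall x y, Order.meet (eta x) (mu y) <= eta (y * x * y^-1)%g.

Lemma Lgenerated_sub theta : Lsubset theta (Lgenerated theta).
Proof.
move=> x; have [_ +] := cmeetP
  [set nu x | nu in [set nu : G -> L | Lsubgroup nu /\ Lsubset theta nu]].
by apply=> _ [nu [_ +] <-]; apply.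
Qed.

Lemma Lgenerated_min theta nu :
  Lsubgroup nu -> Lsubset theta nu -> Lsubset (Lgenerated theta) nu.
Proof.
move=> gnu snu x; have [+ _] := cmeetP
  [set nu x | nu in [set nu : G -> L | Lsubgroup nu /\ Lsubset theta nu]].
by apply; exists nu.
Qed.

Lemma Lgenerated_subgroup theta : Lsubgroup (Lgenerated theta).
Proof.
have le_inv x : Lgenerated theta x <= Lgenerated theta (x^-1)%g.
  have [_ +] := cmeetP [set nu (x^-1)%g | nu in
    [set nu : G -> L | Lsubgroup nu /\ Lsubset theta nu]].
  apply=> _ [nu [gnu snu] <-]; rewrite gnu.2.
  exact: (Lgenerated_min gnu snu).
split=> [x y|x]; last first.
  by apply/le_anti; rewrite le_inv -{2}[x]invgK le_inv.
have [_ +] := cmeetP [set nu (x * y)%g | nu in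
  [set nu : G -> L | Lsubgroup nu /\ Lsubset theta nu]].
apply=> _ [nu [gnu snu] <-]; apply: le_trans (gnu.1 x y).
by apply: leI2; apply: (Lgenerated_min gnu snu).
Qed.

Lemma Lpoint_inP a x mu : Lpoint_in a x mu <-> Lsubset (Lpoint a x) mu.
Proof.
split=> [ax y|/(_ x)]; last by rewrite /Lpoint eqxx.
by rewrite /Lpoint; case: eqP => [->|_] //; apply: le0x.
Qed.

Lemma Lconj_Lpoint eta a x b y :
  Lpoint a x = Lpoint b y -> Lconj eta a x = Lconj eta b y.
Proof.
move=> e; apply/funext => z; rewrite /Lconj.
have := congr1 (@^~ x) e; have := congr1 (@^~ y) e.
rewrite /= /Lpoint !eqxx (eq_sym y).
by case: eqP => [-> ->|_ <- ->] //; rewrite !meet0x.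
Qed.

Lemma Lconj_subgroup_of mu eta a z : Lsubgroup mu -> Lsubgroup_of mu eta ->
  Lpoint_in a z mu -> Lsubgroup_of mu (Lconj eta a z).
Proof.
move=> gmu [geta seta] az; split; first split=> [x y|x]; rewrite /Lconj.
- rewrite meetACA meetxx; apply: leI2 => //; apply: le_trans (geta.1 _ _) _.
  by rewrite !mulgA mulgVK.
- by rewrite -geta.2 !invgM !invgK mulgA.
move=> x; have {2}-> : x = (z^-1 * ((z * x * z^-1) * z))%g.
  by rewrite mulgVK mulKg.
rewrite /Lpoint_in in az; apply: le_trans (gmu.1 _ _); rewrite gmu.2.
rewrite lexI (le_trans (leIl _ _) az) /=.
apply: le_trans (gmu.1 _ _); rewrite lexI (le_trans (leIl _ _) az) andbT.
exact: le_trans (leIr _ _) (seta _).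
Qed.

End LSubgroups.

(* Main.v *)
(* For [eta] normal in [mu] and [a <= mu x], normality applied to [x] and to
   [x^-1] shows that the conjugate of [eta] by [a_x] is [a /\ eta]. Since
   [eta 1] is the top value of [eta], this is also the conjugate of [eta] by
   the L-point [b_1] with [b = a /\ eta 1], which already lies in [eta]. *)
Require Import Defs.
From HB Require Import structures.
From mathcomp Require Import all_boot all_order.
From mathcomp Require Import boolp.

Set Implicit Arguments.
Unset Strict Implicit.
Unset Printing Implicit Defensive.

Import Order.TTheory.

Local Open Scope order_scope.

Lemma Lsubgroup_le1 (d : Order.disp_t) (L : completeLatticeType d)
    (G : groupType) (eta : G -> L) (x : G) :
  Lsubgroup eta -> eta x <= eta 1%g.
Proof.
by case=> etaM etaV; have := etaM x (x^-1)%g; rewrite etaV meetxx mulgV.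
Qed.

Lemma Lconj_normal (d : Order.disp_t) (L : completeLatticeType d)
    (G : groupType) (mu eta : G -> L) (a : L) (x : G) :
  Lsubgroup mu -> Lnormal mu eta -> Lpoint_in a x mu ->
  Lconj eta a x = fun z => Order.meet a (eta z).
Proof.
move=> [_ muV] [_ eta_normal] ax; apply/funext => z; apply/le_anti.
rewrite /Lconj !lexI !leIl /=; apply/andP; split.
  (* Conjugating [x * z * x^-1] by [x^-1] gives back [z], and [a <= mu x = mu (x^-1)]. *)
  have := eta_normal (x * z * x^-1)%g (x^-1)%g.
  rewrite invgK muV -!mulgA mulKg mulVg mulg1; apply: le_trans.
  by rewrite meetC leI2.
by apply: le_trans (eta_normal z x); rewrite meetC leI2.
Qed.

Theorem theorem4p2 (d : Order.disp_t) (L : completelyDistrLatticeType d)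
    (G : groupType) (mu : G -> L) (hmu : Lsubgroup mu)
    (eta : G -> L) (heta : Lnormal mu eta) :
  Lpronormal mu eta.
Proof.
have [eta_sub _] := heta; have [eta_group _] := eta_sub.
(* The meet with [eta 1] is what puts the point in [eta]: [a] alone need not lie below [eta 1]. *)
split=> // a x ax; exists (Order.meet a (eta 1%g)), 1%g; split.
  apply: le_trans (Lgenerated_sub _ _).
  exact: le_trans (leIr _ _) (leUl _ _).
rewrite (Lconj_normal hmu heta ax); apply/funext => z.
rewrite /Lconj mul1g invg1 mulg1 -meetA; congr Order.meet.
(* The cut by [eta 1] is invisible, as [eta z <= eta 1]. *)
exact/meet_r/Lsubgroup_le1.
Qed.
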